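(* Let $X=(X_1,\dots,X_d)$ be a random vector of real inputs such that no input can be expressed almost surely as a deterministic (measurable) function of some or all of the others, let $G\in L^2(P_X)$ be a model with $\mathbb{V}(G(X))>0$, let $D=\{1,\dots,d\}$ and let $E\subseteq D$. Suppose that $X_E$ is the largest $L^2$-exogenous subset of inputs to $G$ among $X$, i.e. $X_E$ is $L^2$-exogenous to $G$ and no subset $X_A$ with $A\subseteq D$, $A\ne E$ and $|A|\ge|E|$ is $L^2$-exogenous to $G$. Then the proportional marginal effects satisfy $$\mathrm{PME}_i=0\ \text{ for all } i\in E,\qquad \mathrm{PME}_j>0\ \text{ for all } j\in D\setminus E.$$
   Context: Notation: $P_X$ is the distribution of $X$; for $A\subseteq D$, $X_A=(X_i)_{i\in A}$, $\overline{A}=D\setminus A$, $P_{X_A}$ is the distribution of $X_A$, and $L^2(P_{X_A})$ is the space of measurable functions of $X_A$ with finite second moment (constants if $A=\emptyset$). $\mathbb{E}$ and $\mathbb{V}$ denote expectation and variance, and $Y=G(X)$. $L^2$-exogeneity: $X_E$ ($E\subseteq D$) is $L^2$-exogenous to $G$ if for every $B\subseteq E$ there exists $f\in L^2(P_{X_{\overline{B}}})$ such that $G(X)=f(X_{\overline{B}})$ almost surely. Total Sobol' indices: for $A\subseteq D$, $$S^T_A=\frac{\mathbb{E}\big[\mathbb{V}(G(X)\mid X_{\overline{A}})\big]}{\mathbb{V}(G(X))}.$$ The map $S^T: A\mapsto S^T_A$ is nonnegative and monotone for inclusion, with $S^T_\emptyset=0$. Ratio potential: for a finite set $A$ and a function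 $u$ on $\mathcal{P}(A)$ with $u(B)>0$ for every nonempty $B\subseteq A$, $R(\emptyset,u)=1$ and, for $A\neq\emptyset$, $R(A,u)=u(A)\big(\sum_{j\in A}R(A\setminus\{j\},u)^{-1}\big)^{-1}$. Extended proportional values: for $v:\mathcal{P}(D)\to[0,\infty)$ monotone for inclusion with $v(\emptyset)=0$, let $k_{\max}=\max\{|A|:A\subseteq D,\ v(A)=0\}$, $\mathcal{K}=\{A\subseteq D: v(A)=0,\ |A|=k_{\max}\}$, $\mathcal{K}_{-i}=\{A\subseteq D\setminus\{i\}: v(A)=0,\ |A|=k_{\max}\}$, and $v_A(B)=v(A\cup B)$ for $B\subseteq D\setminus A$. Then $\mathrm{PV}^0((D,v))\in\mathbb{R}^d$ is given by $\mathrm{PV}^0_i=0$ if $i\in A$ for all $A\in\mathcal{K}$, and otherwise $$\mathrm{PV}^0_i=\frac{\sum_{A\in\mathcal{K}_{-i}}R\big((D\setminus\{i\})\setminus A,v_A\big)^{-1}}{\sum_{A\in\mathcal{K}}R\big(D\setminus A,v_A\big)^{-1}}.$$ Proportional marginal effects: $\mathrm{PME}=(\mathrm{PME}_1,\dots,\mathrm{PME}_d)=\mathrm{PV}^0((D,S^T))$. *)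

(* Defs.v *)
(* MathComp-Analysis. *)
From HB Require Import structures.
From mathcomp Require Import all_boot all_order all_algebra.
From mathcomp Require Import all_classical all_reals all_analysis.

Set Implicit Arguments.
Unset Strict Implicit.
Unset Printing Implicit Defensive.

Import Order.TTheory GRing.Theory Num.Theory.
Import numFieldNormedType.Exports.

Local Open Scope classical_set_scope.
Local Open Scope ring_scope.

(* x_A, listed in increasing order of the indices; for A = set0 the target
   0.-tuple R is a point, so the functions of x_A are the constants. *)
Definition coords (R : realType) (d : nat) (A : {set 'I_d})
    (x : d.-tuple R) : #|A|.-tuple R :=
  [tuple tnth x (enum_val k) | k < #|A|].

Section coords_measurable.
Context (R : realType) (d : nat) (A : {set 'I_d}).

Let measurable_coords : measurable_fun [set: d.-tuple R] (@coords R d A).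
Proof.
apply/measurable_fun_tnthP => k.
rewrite (_ : _ \o _ = (fun x : d.-tuple R => tnth x (enum_val k))).
  exact: measurable_tnth.
by apply/funext => x /=; rewrite tnth_mktuple.
Qed.

HB.instance Definition _ := isMeasurableFun.Build _ _ _ _ (@coords R d A)
  measurable_coords.

End coords_measurable.

Section conditioning.
Context d d' (T : measurableType d) (T' : measurableType d') (R : realType).
Variable P : probability T R.
Implicit Types (Y : T -> R) (Z : {mfun T >-> T'}).

(* h is a version of z |-> E[Y | Z = z] *)
Definition is_cond_exp Y Z (h : T' -> R) : Prop :=
  [/\ measurable_fun [set: T'] h,
      P.-integrable [set: T] (EFin \o (h \o Z)) &
      forall C, measurable C ->
        (\int[P]_(w in Z @^-1` C) (h (Z w))%:E
         = \int[P]_(w in Z @^-1` C) (Y w)%:E)%E].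

(* E[Y | Z] as a random variable, for one fixed version, which exists as soon as
   Y is integrable; the value cst 0 is only a default for the other cases. *)
Definition cond_exp Y Z : T -> R := xget (cst 0) (is_cond_exp Y Z) \o Z.

Definition cond_var Y Z : T -> R := cond_exp ((Y \- cond_exp Y Z) ^+ 2) Z.

End conditioning.

Section inputs.
Context disp (T : measurableType disp) (R : realType) (P : probability T R).
Context (d : nat).
Implicit Types (X : {RV P >-> d.-tuple R}) (G : d.-tuple R -> R)
  (E : {set 'I_d}).

Definition subvector X (A : {set 'I_d}) : {RV P >-> #|A|.-tuple R} :=
  [the {mfun T >-> #|A|.-tuple R} of coords A \o X].

Definition no_deterministic_input X : Prop :=
  forall (i : 'I_d) (A : {set 'I_d}), i \notin A ->
    ~ exists2 f : #|A|.-tuple R -> R, measurable_fun [set: #|A|.-tuple R] f &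
        {ae P, forall w, tnth (X w) i = f (subvector X A w)}.

Definition L2_exogenous G X E : Prop :=
  forall B : {set 'I_d}, B \subset E ->
    exists2 f : #|~: B|.-tuple R -> R,
      f \in Lfun (distribution P (subvector X (~: B))) 2%:E &
      {ae P, forall w, G (X w) = f (subvector X (~: B) w)}.

Definition total_sobol G X (A : {set 'I_d}) : R :=
  fine ('E_P[cond_var P (G \o X) (subvector X (~: A))])%E
  / fine ('V_P[G \o X])%E.

End inputs.

Section proportional_values.
Context (R : realFieldType) (D : finType).
Implicit Types (A : {set D}) (u v : {set D} -> R).

(* The first argument is the cardinality of the second one. *)
Fixpoint ratio_potential_rec (n : nat) A u : R :=
  if n is m.+1 then
    u A * (\sum_(j in A) (ratio_potential_rec m (A :\ j) u)^-1)^-1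
  else 1.

Definition ratio_potential A u : R := ratio_potential_rec #|A| A u.

Definition null_card v : nat := (\max_(A : {set D} | v A == 0%R) #|A|)%N.

Definition null_coalitions v : {set {set D}} :=
  [set A : {set D} | (v A == 0) && (#|A| == null_card v)]%SET.

Definition null_coalitions_avoiding v (i : D) : {set {set D}} :=
  [set A : {set D} |
    [&& A \subset [set~ i]%SET, v A == 0 & #|A| == null_card v]]%SET.

Definition marginal_game v A (B : {set D}) : R := v (A :|: B).

Definition PV0 v (i : D) : R :=
  if [forall A in null_coalitions v, i \in A] then 0
  else
    (\sum_(A in null_coalitions_avoiding v i)
       (ratio_potential ([set~ i] :\: A)%SET (marginal_game v A))^-1)
    / (\sum_(A in null_coalitions v)
         (ratio_potential (~: A) (marginal_game v A))^-1).

End proportional_values.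

Definition PME disp (T : measurableType disp) (R : realType)
    (P : probability T R) (d : nat) (G : d.-tuple R -> R)
    (X : {RV P >-> d.-tuple R}) : 'I_d -> R :=
  PV0 (total_sobol G X).

(* Main.v *)
(* For Y = G(X) and Z the vector of the inputs outside A, the numerator of S^T_A
   is the squared L^2 distance from Y to E[Y | Z], so S^T_A = 0 iff Y is almost
   surely a function of Z, i.e. iff X_A is exogenous: a function of Z is also a
   function of any larger subvector of X.  Maximality of E then makes E the only
   null coalition of maximal cardinality, hence PME_i = 0 on E, and off E the
   index PME_j is a quotient of positive ratio potentials of the game
   B |-> S^T_(E u B). *)
Require Import Defs.
From HB Require Import structures.
From mathcomp Require Import all_boot all_order all_algebra.
From mathcomp Require Import all_classical all_reals all_analysis.
From mathcomp Require Import measurable_realfun lra.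

Set Implicit Arguments.
Unset Strict Implicit.
Unset Printing Implicit Defensive.

Import Order.TTheory GRing.Theory Num.Theory.
Import numFieldNormedType.Exports.

Local Open Scope classical_set_scope.
Local Open Scope ring_scope.

(** * Conditional expectations given a random element: existence, linearity, positivity, uniqueness,
    Jensen *)

Section conditional_expectation.
Context d d' (T : measurableType d) (T' : measurableType d') (R : realType).
Variable P : probability T R.
Implicit Types (Y : T -> R) (Z : {mfun T >-> T'}) (h f : T' -> R).

Lemma preimage_mfun_measurable Z C : measurable C -> measurable (Z @^-1` C).
Proof. by move=> mC; rewrite -[X in measurable X]setTI; exact: measurable_funP. Qed.

(** Push the signed measure [Y dP] forward along [Z]; its Radon-Nikodym derivative with respect to
    the law of [Z], made real-valued by [fine], is a version. *)
Lemma is_cond_exp_exists Y Z : P.-integrable [set: T] (EFin \o Y) ->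
  exists h, is_cond_exp P Y Z h.
Proof.
move=> intY.
have mZ : measurable_fun [set: T] Z by [].
pose nu0 : {charge set T -> \bar R} := induced_charge intY.
pose pushforward_nu0 : {charge set T' -> \bar R} := pushforward nu0 Z.
pose nu := pushforward_nu0 mZ.
pose mu : probability T' R := distribution P Z.
(* If the law of [Z] gives [C] mass zero, then [Y] is integrated over a [P]-null set. *)
have numu : nu `<< mu.
  apply/null_content_dominatesP => C mC muC.
  apply: null_set_integral => //; first exact: preimage_mfun_measurable.
  by apply: measurable_funTS; exact: measurable_int intY.
have intf := Radon_Nikodym_integrable numu.
have mf := measurable_int _ intf.
have fE : Radon_Nikodym nu mu = EFin \o (fine \o Radon_Nikodym nu mu).
  by apply/funext => z /=; rewrite fineK// Radon_Nikodym_fin_num.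
have mh : measurable_fun [set: T'] (fine \o Radon_Nikodym nu mu).
  by apply/measurable_EFinP; rewrite -fE.
have inth : P.-integrable [set: T] (EFin \o ((fine \o Radon_Nikodym nu mu) \o Z)).
  rewrite compA -fE; apply/integrableP; split.
    exact: measurableT_comp.
  move/integrableP : intf => [_]; rewrite ge0_integral_distribution//.
  exact: measurableT_comp.
exists (fine \o Radon_Nikodym nu mu); split => // C mC.
have := Radon_Nikodym_integral numu mC.
have mZC := preimage_mfun_measurable Z mC.
have mEh : measurable_fun [set: T'] (EFin \o (fine \o Radon_Nikodym nu mu)).
  exact/measurable_EFinP.
rewrite fE (integral_pushforward mZ mEh _ mC)//.
exact: integrableS inth.
Qed.

Lemma cond_expP Y Z : P.-integrable [set: T] (EFin \o Y) ->
  exists2 h, is_cond_exp P Y Z h & cond_exp P Y Z = h \o Z.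
Proof.
move=> /is_cond_exp_exists-/(_ Z) [h hP].
exists (xget (cst 0) (is_cond_exp P Y Z)) => //.
exact: xgetI hP.
Qed.

Lemma is_cond_expZD a Y1 Y2 Z h1 h2 :
  P.-integrable [set: T] (EFin \o Y1) -> P.-integrable [set: T] (EFin \o Y2) ->
  is_cond_exp P Y1 Z h1 -> is_cond_exp P Y2 Z h2 ->
  is_cond_exp P (fun w => a * Y1 w + Y2 w) Z (fun z => a * h1 z + h2 z).
Proof.
move=> i1 i2 [mh1 ih1 e1] [mh2 ih2 e2].
have intZD (Y Y' : T -> R) : P.-integrable [set: T] (EFin \o Y) ->
    P.-integrable [set: T] (EFin \o Y') -> forall C, measurable C ->
    (\int[P]_(w in Z @^-1` C) (a * Y w + Y' w)%:E
     = a%:E * \int[P]_(w in Z @^-1` C) (Y w)%:E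
       + \int[P]_(w in Z @^-1` C) (Y' w)%:E)%E.
  move=> i i' C mC; have mZC := preimage_mfun_measurable Z mC.
  under eq_integral do rewrite EFinD EFinM.
  have {}i : P.-integrable (Z @^-1` C) (EFin \o Y) by exact: integrableS i.
  have {}i' : P.-integrable (Z @^-1` C) (EFin \o Y') by exact: integrableS i'.
  by rewrite integralD//= ?integralZl//; exact: integrableZl.
split.
- by apply: measurable_funD => //; exact: measurable_funM.
- exact: (integrableD measurableT (integrableZl measurableT a ih1) ih2).
- by move=> C mC; rewrite !intZD// e1// e2.
Qed.

(** Test against [C = {h < 0}]: the integral of [|h(Z)|] over the preimage of [C] is minus that of
    [Y], hence zero, so [h(Z)] vanishes almost everywhere where it is negative. *)
Lemma is_cond_exp_ge0 Y Z h : (forall w, 0 <= Y w) -> is_cond_exp P Y Z h ->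
  {ae P, forall w, 0 <= h (Z w)}.
Proof.
move=> Y0 [mh ih e].
pose C := [set z | h z < 0].
have mC : measurable C.
  rewrite (_ : C = h @^-1` `]-oo, 0[); last first.
    by apply/seteqP; split => z /=; rewrite in_itv.
  by rewrite -[X in measurable X]setTI; exact: mh.
have mZC := preimage_mfun_measurable Z mC.
have mhZ : measurable_fun (Z @^-1` C) (fun w => (h (Z w))%:E).
  apply: measurable_funTS; exact: measurable_int ih.
have : (\int[P]_(w in Z @^-1` C) `|(h (Z w))%:E| = 0)%E.
  apply/eqP; rewrite eq_le integral_ge0// andbT.
  rewrite (eq_integral (fun w => - (h (Z w))%:E)%E); last first.
    by move=> w; rewrite inE /= => hw; rewrite ltr0_norm.
  rewrite integralN; last first.
    by apply: integrable_add_def => //; apply: integrableS ih.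
  by rewrite e// oppe_le0 integral_ge0// => w _; rewrite lee_fin.
move=> /(ae_eq_integral_abs P mZC mhZ); apply: filterS => w /= wC.
rewrite leNgt; apply/negP => hw.
by have [h0] := wC hw; rewrite h0 ltxx in hw.
Qed.

(** The difference of two versions is a version for [-Y + Y = 0], so positivity applies to it in
    both orders. *)
Lemma is_cond_exp_ae_unique Y Z h f : P.-integrable [set: T] (EFin \o Y) ->
  is_cond_exp P Y Z h -> is_cond_exp P Y Z f ->
  {ae P, forall w, h (Z w) = f (Z w)}.
Proof.
move=> iY.
have le h1 h2 : is_cond_exp P Y Z h1 -> is_cond_exp P Y Z h2 ->
    {ae P, forall w, h1 (Z w) <= h2 (Z w)}.
  move=> /(is_cond_expZD (-1) iY iY)/[apply]/is_cond_exp_ge0.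
  move=> H; have : {ae P, forall w, 0 <= -1 * h1 (Z w) + h2 (Z w)}.
    by apply: H => w; lra.
  by apply: filterS => w; lra.
move=> hh hf; have := le _ _ hh hf; have := le _ _ hf hh.
by apply: filterS2 => w ? ?; apply/eqP; rewrite eq_le; apply/andP.
Qed.

(* Conditional Jensen: [(Y - q)^2 >= 0] gives [k - 2 q h + q^2 >= 0] for all
   rational [q] simultaneously, and [q] can be taken arbitrarily close to [h]. *)
Lemma is_cond_exp_sqr_le Y Z h k : P.-integrable [set: T] (EFin \o Y) ->
  P.-integrable [set: T] (EFin \o (fun w => Y w ^+ 2)) ->
  is_cond_exp P Y Z h -> is_cond_exp P (fun w => Y w ^+ 2) Z k ->
  {ae P, forall w, h (Z w) ^+ 2 <= k (Z w)}.
Proof.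
move=> iY iY2 hh hk.
have Hq (q : rat) :
    {ae P, forall w, 0 <= -2 * ratr q * h (Z w) + (1 * k (Z w) + ratr q ^+ 2)}.
  have icst : P.-integrable [set: T] (EFin \o (fun=> ratr q ^+ 2 : R)).
    exact: finite_measure_integrable_cst.
  have hc : is_cond_exp P (fun=> ratr q ^+ 2) Z (fun=> ratr q ^+ 2) by [].
  have h1 := is_cond_expZD 1 iY2 icst hk hc.
  have i1 : P.-integrable [set: T] (EFin \o (fun w => 1 * Y w ^+ 2 + ratr q ^+ 2)).
    have := integrableD measurableT iY2 icst.
    by apply: eq_integrable => // w _ /=; rewrite mul1r.
  have h2 := is_cond_expZD (-2 * ratr q) iY i1 hh h1.
  apply: is_cond_exp_ge0 h2 => w.
  have := sqr_ge0 (Y w - ratr q); lra.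
(* The rationals are enumerated through [unpickle], so a countable union of null sets gives one null
   set for all [q]. *)
have : {ae P, forall w, forall n : nat, forall q : rat, unpickle n = Some q ->
    0 <= -2 * ratr q * h (Z w) + (1 * k (Z w) + ratr q ^+ 2)}.
  apply/ae_foralln => n; case: (unpickle n) => [q|]; last exact: aeW.
  by apply: filterS (Hq q) => w ? _ [<-].
apply: filterS => w /(_ _ _ (pickleK _)) Hw.
rewrite leNgt; apply/negP => kh.
set a := h (Z w) in Hw kh *; set b := k (Z w) in Hw kh *.
(* For [|q - a| < e] the quadratic [q^2 - 2 q a + b = (q - a)^2 - e^2] is negative, against [Hw]. *)
pose e := Num.sqrt (a ^+ 2 - b).
have e0 : 0 < e by rewrite sqrtr_gt0 subr_gt0.
have e2 : e ^+ 2 = a ^+ 2 - b by rewrite sqr_sqrtr// subr_ge0 ltW.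
have [q] : exists q, ratr q \in `]a - e, a + e[.
  by apply: rat_in_itvoo; lra.
rewrite in_itv /= => /andP[qa qe].
have := Hw q; nra.
Qed.

End conditional_expectation.
Lemma Lfun2P d (T : measurableType d) (R : realType)
    (mu : {measure set T -> \bar R}) (f : T -> R) : measurable_fun [set: T] f ->
  f \in Lfun mu 2%:E <-> mu.-integrable [set: T] (EFin \o (fun w => f w ^+ 2)).
Proof.
move=> mf; split; first exact: Lfun2_integrable_sqr.
move=> /integrableP[_ fy]; apply/andP; split; rewrite inE//=.
rewrite /finite_norm unlock; apply: poweR_lty.
rewrite (eq_integral (fun w => `|(f w ^+ 2)%:E|%E)) // => w _ /=.
by rewrite powR_mulrn// normrX.
Qed.

(** * Square-integrable variables and the expected conditional variance *)

Section conditional_variance.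
Context d (T : measurableType d) (R : realType) (P : probability T R).

Lemma ae_eq_Lfun2 (f g : T -> R) : measurable_fun [set: T] g ->
  {ae P, forall w, f w = g w} -> f \in Lfun P 2%:E -> g \in Lfun P 2%:E.
Proof.
move=> mg fg f2; have mf : measurable_fun [set: T] f.
  by move: f2; rewrite inE => /andP[/[!inE]].
apply/(Lfun2P _ mg); have /integrableP[mf2 fy] := Lfun2_integrable_sqr f2.
have mg2 : measurable_fun [set: T] (EFin \o (fun w => g w ^+ 2)).
  by apply/measurable_EFinP; exact: measurable_funX.
apply/integrableP; split => //; apply: le_lt_trans fy.
rewrite le_eqVlt; apply/orP; left; apply/eqP.
apply: ge0_ae_eq_integral => //; [exact: measurableT_comp..|].
by apply: filterS fg => w /= -> _.
Qed.

Context d' (T' : measurableType d').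
Implicit Types (Y : T -> R) (Z : {mfun T >-> T'}).

Lemma Lfun_distribution2 Z (f : T' -> R) : measurable_fun [set: T'] f ->
  f \in Lfun (distribution P Z) 2%:E <-> f \o Z \in Lfun P 2%:E.
Proof.
move=> mf; have mfZ : measurable_fun [set: T] (f \o Z) by exact: measurableT_comp.
have mf2 : measurable_fun [set: T'] (EFin \o (fun z => f z ^+ 2)).
  by apply/measurable_EFinP; exact: measurable_funX.
have E : (\int[distribution P Z]_z `|(f z ^+ 2)%:E| =
          \int[P]_w `|(f (Z w) ^+ 2)%:E|)%E.
  by rewrite ge0_integral_distribution//; exact: measurableT_comp.
split=> [/(Lfun2P _ mf)/integrableP[_] fy|/(Lfun2P _ mfZ)/integrableP[_] fy].
  apply/(Lfun2P _ mfZ)/integrableP; split; last by rewrite -E.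
  exact/measurable_EFinP/measurable_funX.
by apply/(Lfun2P _ mf)/integrableP; split => //; rewrite E.
Qed.

Lemma Lfun2_integrable Y : Y \in Lfun P 2%:E -> P.-integrable [set: T] (EFin \o Y).
Proof.
by move=> Y2; apply/Lfun1_integrable; rewrite Lfun_subset12 ?fin_num_measure.
Qed.

(** This ensures that [cond_var] is a genuine conditional expectation and not the default value of
    [cond_exp]. Conditional Jensen bounds [h(Z)^2] by the integrable [k(Z)]. *)
Lemma cond_exp_residual_integrable Y Z : Y \in Lfun P 2%:E ->
  P.-integrable [set: T] (EFin \o (fun w => (Y w - cond_exp P Y Z w) ^+ 2)).
Proof.
move=> Y2; have iY := Lfun2_integrable Y2; have iY2 := Lfun2_integrable_sqr Y2.
have [h hP ->] := cond_expP Z iY; have [k kP _] := cond_expP Z iY2.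
have hk := is_cond_exp_sqr_le iY iY2 hP kP.
have [mh ih _] := hP; have [mk ik _] := kP.
have mhZ2 : measurable_fun [set: T] (EFin \o (fun w => h (Z w) ^+ 2)).
  apply/measurable_EFinP/measurable_funX; exact/measurable_EFinP/measurable_int/ih.
have ih2 : P.-integrable [set: T] (EFin \o (fun w => h (Z w) ^+ 2)).
  apply/integrableP; split => //.
  move/integrableP : ik => [mkZ]; apply: le_lt_trans.
  apply: ae_ge0_le_integral => //; [exact: measurableT_comp..|].
  apply: filterS hk => w hw _ /=; rewrite lee_fin ger0_norm ?sqr_ge0//.
  by rewrite ger0_norm// (le_trans _ hw)// sqr_ge0.
have mY : measurable_fun [set: T] Y by exact/measurable_EFinP/measurable_int/iY.
(* The dominating function is [2 Y^2 + 2 h(Z)^2]; it exceeds [(Y - h(Z))^2] by [(Y + h(Z))^2]. *)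
have := integrableD measurableT (integrableZl measurableT 2 iY2)
  (integrableZl measurableT 2 ih2).
apply: le_integrable => //.
  apply/measurable_EFinP/measurable_funX/measurable_funB => //.
  exact/measurable_EFinP/measurable_int/ih.
move=> w _ /=; rewrite lee_fin !ger0_norm ?sqr_ge0//.
  have := sqr_ge0 (Y w + h (Z w)); rewrite /GRing.exp /=; nra.
by apply: addr_ge0; apply: mulr_ge0 => //; exact: sqr_ge0.
Qed.

Lemma expectation_cond_var Y Z : Y \in Lfun P 2%:E ->
  ('E_P[cond_var P Y Z] =
   \int[P]_w ((Y w - cond_exp P Y Z w) ^+ 2)%:E)%E.
Proof.
move=> Y2; rewrite unlock /cond_var.
rewrite (_ : _ ^+ 2 = fun w => (Y w - cond_exp P Y Z w) ^+ 2)//.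
have [h [_ _ hE] ->] := cond_expP Z (cond_exp_residual_integrable Z Y2).
(* The defining identity is tested on the whole target space. *)
by rewrite -[[set: T]](preimage_setT Z) -hE.
Qed.

Lemma expectation_cond_var_ge0 Y Z : Y \in Lfun P 2%:E ->
  (0 <= 'E_P[cond_var P Y Z])%E.
Proof.
move=> Y2; rewrite expectation_cond_var//; apply: integral_ge0 => w _.
by rewrite lee_fin; exact: sqr_ge0.
Qed.

Lemma expectation_cond_var_fin_num Y Z : Y \in Lfun P 2%:E ->
  'E_P[cond_var P Y Z]%E \is a fin_num.
Proof.
move=> Y2; rewrite expectation_cond_var//.
exact: integrable_fin_num (cond_exp_residual_integrable Z Y2).
Qed.

Lemma is_cond_exp_ae_comp Y Z f : P.-integrable [set: T] (EFin \o Y) ->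
  measurable_fun [set: T'] f -> {ae P, forall w, Y w = f (Z w)} ->
  is_cond_exp P Y Z f.
Proof.
move=> iY mf Yf; have mY := measurable_int _ iY.
have mfZ : measurable_fun [set: T] (EFin \o (f \o Z)).
  by apply/measurable_EFinP; exact: measurableT_comp.
split => //.
  apply/integrableP; split => //.
  move/integrableP : iY => [_]; apply: le_lt_trans.
  rewrite le_eqVlt; apply/orP; left; apply/eqP.
  apply: ge0_ae_eq_integral => //; [exact: measurableT_comp..|].
  by apply: filterS Yf => w /= -> _.
move=> C mC; apply: ae_eq_integral => //.
- exact: preimage_mfun_measurable.
- exact: measurable_funTS.
- exact: measurable_funTS.
- by apply: filterS Yf => w /= -> _.
Qed.

(** A nonnegative residual with zero integral vanishes almost surely. Conversely, if [Y = f(Z)] then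
    [f] is itself a version of [E[Y | Z]], and uniqueness identifies it with the version chosen by
    [cond_exp]. *)
Lemma expectation_cond_var_eq0 Y Z : Y \in Lfun P 2%:E ->
  ('E_P[cond_var P Y Z] = 0)%E <->
  exists2 f : T' -> R, measurable_fun [set: T'] f &
    {ae P, forall w, Y w = f (Z w)}.
Proof.
move=> Y2; have iY := Lfun2_integrable Y2; rewrite expectation_cond_var//.
have mres := measurable_int _ (cond_exp_residual_integrable Z Y2).
have res0 w : (0 <= ((Y w - cond_exp P Y Z w) ^+ 2)%:E)%E.
  by rewrite lee_fin; exact: sqr_ge0.
have intE : (\int[P]_w ((Y w - cond_exp P Y Z w) ^+ 2)%:E =
             \int[P]_w `|((Y w - cond_exp P Y Z w) ^+ 2)%:E|)%E.
  by apply: eq_integral => w _; rewrite gee0_abs.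
rewrite intE; split.
  move=> /(ae_eq_integral_abs P measurableT mres).
  have [h [mh _ _] ->] := cond_expP Z iY => hY; exists h => //.
  apply: filterS hY => w /= /(_ I) [] /eqP.
  by rewrite sqrf_eq0 subr_eq0 => /eqP.
move=> [f mf Yf]; apply/(ae_eq_integral_abs P measurableT mres).
have fP := is_cond_exp_ae_comp iY mf Yf.
have [h hP hE] := cond_expP Z iY.
have := is_cond_exp_ae_unique iY hP fP.
apply: filterS2 Yf => w Yw hw _ /=; by rewrite hE /= Yw hw subrr expr0n.
Qed.

End conditional_variance.

(** * Passing from a subvector to a smaller one *)

Section coordinate_restriction.
Context (R : realType) (d : nat) (A B : {set 'I_d}).
Hypothesis AB : A \subset B.

(** The index is the rank in [B] of the [k]-th element of [A]. [enum_rank_in] asks for a proof that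
    [B] is inhabited, and this very element supplies it. *)
Definition coords_restr (y : #|B|.-tuple R) : #|A|.-tuple R :=
  [tuple tnth y (enum_rank_in (fintype.subsetP AB _ (enum_valP k)) (enum_val k))
    | k < #|A|].

Lemma coords_restrK (x : d.-tuple R) : coords_restr (coords B x) = coords A x.
Proof.
apply: eq_from_tnth => k; rewrite !tnth_mktuple enum_rankK_in//.
exact: fintype.subsetP AB _ (enum_valP k).
Qed.

Lemma measurable_coords_restr :
  measurable_fun [set: #|B|.-tuple R] coords_restr.
Proof.
apply/measurable_fun_tnthP => k; rewrite /comp.
under eq_fun do rewrite tnth_mktuple.
exact: measurable_tnth.
Qed.

End coordinate_restriction.

(** * Zeros of the total Sobol' indices and exogeneity *)

Section total_sobol.
Context disp (T : measurableType disp) (R : realType) (P : probability T R).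
Context (d : nat) (X : {RV P >-> d.-tuple R}) (G : d.-tuple R -> R).
Hypothesis G2 : G \in Lfun (distribution P X) 2%:E.
Implicit Types A : {set 'I_d}.

Let GX2 : G \o X \in Lfun P 2%:E.
Proof.
apply/Lfun_distribution2 => //.
by move: G2; rewrite inE => /andP[/[!inE]].
Qed.

Lemma total_sobol_ge0 A : 0 <= total_sobol G X A.
Proof.
apply: divr_ge0; apply: fine_ge0; last exact: variance_ge0.
exact: expectation_cond_var_ge0.
Qed.

Hypothesis V0 : (0 < 'V_P[G \o X])%E.

Lemma total_sobol_eq0 A : total_sobol G X A = 0 <-> L2_exogenous G X A.
Proof.
have V1 : fine 'V_P[G \o X]%E != 0.
  by rewrite gt_eqF// fine_gt0// V0 ltey_eq variance_fin_num.
have SE : total_sobol G X A = 0 <->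
    ('E_P[cond_var P (G \o X) (subvector X (~: A))] = 0)%E.
  split=> [/eqP|SA0]; last by rewrite /total_sobol SA0 mul0r.
  (* [fine] also sends infinite values to 0, hence the finiteness of the numerator. *)
  rewrite mulf_eq0 invr_eq0 (negbTE V1) orbF fine_eq0 => [/eqP//|].
  exact: expectation_cond_var_fin_num.
apply: (iff_trans SE); apply: (iff_trans (expectation_cond_var_eq0 _ GX2)).
split=> [[f mf Gf] B BA|/(_ A (subxx A))[f f2 Gf]]; last first.
  by exists f => //; move: f2; rewrite inE => /andP[/[!inE]].
(* One [f] for [A] serves every [B] inside [A]: the complement of [B] is larger, so [f] is
   precomposed with the restriction. The converse above is the case [B = A]. *)
have AB : ~: A \subset ~: B by rewrite finset.setCS.
have mg : measurable_fun [set: #|~: B|.-tuple R] (f \o coords_restr AB).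
  by apply: measurableT_comp => //; exact: measurable_coords_restr.
have Gg : {ae P, forall w, G (X w) =
    (f \o coords_restr AB) (subvector X (~: B) w)}.
  by apply: filterS Gf => w; rewrite /= coords_restrK.
exists (f \o coords_restr AB) => //.
apply/Lfun_distribution2 => //; apply: ae_eq_Lfun2 Gg GX2.
exact: measurableT_comp.
Qed.

End total_sobol.

(** * Positivity of ratio potentials, and proportional values with a unique largest null
    coalition *)

Section proportional_values_facts.
Context (R : realFieldType) (D : finType).
Implicit Types (A E : {set D}) (u v : {set D} -> R).

(** Induction on the cardinality: for nonempty [A] the sum of inverses has only positive terms, and
    at least one. *)
Lemma ratio_potential_gt0 A u :
  (forall B : {set D}, B \subset A -> B != finset.set0 -> 0 < u B) ->
  0 < ratio_potential A u.
Proof.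
rewrite /ratio_potential; move An : #|A| => n.
elim: n A An => [|n IHn] A An u0 //=.
have A0 : A != finset.set0 by rewrite -card_gt0 An.
have rec_gt0 j : j \in A -> 0 < (ratio_potential_rec n (A :\ j) u)^-1.
  move=> jA; rewrite invr_gt0; apply: IHn => [|B BA B0].
    by move: An; rewrite (cardsD1 j) jA add1n => -[].
  by apply: u0 B0; apply: fintype.subset_trans BA _; exact: subD1set.
apply: mulr_gt0; first exact: u0.
have [j jA] := set0Pn _ A0.
rewrite invr_gt0 (bigD1 j)//= ltr_wpDr ?rec_gt0// sumr_ge0// => i /andP[iA _].
exact/ltW/rec_gt0.
Qed.

Section unique_null_coalition.
Variables (v : {set D} -> R) (E : {set D}).
Hypothesis v0 : forall A, 0 <= v A.
Hypothesis vE : v E = 0.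
Hypothesis v_neq0 : forall A, A != E -> (#|E| <= #|A|)%N -> v A != 0.

Lemma null_card_unique : null_card v = #|E|.
Proof.
apply/eqP; rewrite eqn_leq; apply/andP; split.
  apply/bigmax_leqP => A vA; rewrite leqNgt; apply/negP => EA.
  have AE : A != E by apply: contraTneq EA => ->; rewrite ltnn.
  by have := v_neq0 AE (ltnW EA); rewrite vA.
by rewrite /null_card leq_bigmax_cond ?vE.
Qed.

(** The boolean form rewrites inside both [null_coalitions] and [null_coalitions_avoiding]. *)
Lemma null_coalitionsE A : (v A == 0) && (#|A| == null_card v) = (A == E).
Proof.
rewrite null_card_unique; apply/andP/eqP => [[vA /eqP cA]|->]; last first.
  by rewrite vE !eqxx.
by apply/eqP; apply: contraTT vA => /v_neq0; apply; rewrite cA.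
Qed.

Lemma null_coalitions_unique : null_coalitions v = [set E]%SET.
Proof. by apply/setP => A; rewrite !inE null_coalitionsE. Qed.

Lemma null_coalitions_avoiding_unique i : i \notin E ->
  null_coalitions_avoiding v i = [set E]%SET.
Proof.
move=> iE; apply/setP => A; rewrite !inE null_coalitionsE.
by rewrite andb_idl// => /eqP ->; rewrite -finset.disjoints_subset disjoint_sym disjoints1.
Qed.

(** Adjoining a nonempty [B] disjoint from [E] gives a coalition strictly larger than [E], on which
    [v] is nonzero by [v_neq0], hence positive. *)
Lemma marginal_ratio_potential_gt0 (F : {set D}) :
  F \subset ~: E -> 0 < ratio_potential F (marginal_game v E).
Proof.
move=> FE; apply: ratio_potential_gt0 => B BF B0.
have EB : E \proper E :|: B.
  rewrite properE finset.subsetUl finset.subUset fintype.subxx/=; apply: contra B0 => BE.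
  rewrite -finset.subset0 -(finset.setICr E) finset.subsetI BE.
  exact: fintype.subset_trans BF FE.
rewrite lt_def v0 andbT v_neq0 ?subset_leq_card ?proper_sub//.
by apply: contraTneq EB => ->; rewrite fintype.properxx.
Qed.

Lemma PV0_null i : i \in E -> PV0 v i = 0.
Proof.
move=> iE; rewrite /PV0; case: ifPn => // /forallP[] A.
by rewrite null_coalitions_unique inE; apply/implyP => /eqP ->.
Qed.

(** The coalition [E] itself rules out the zero branch, and both sums reduce to their single term at
    [E], the inverse of a positive potential. *)
Lemma PV0_gt0 i : i \notin E -> 0 < PV0 v i.
Proof.
move=> iE; rewrite /PV0 ifF; last first.
  apply/negP => /forallP/(_ E).
  by rewrite null_coalitions_unique inE eqxx (negbTE iE).
rewrite null_coalitions_avoiding_unique// null_coalitions_unique !big_set1.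
rewrite divr_gt0// invr_gt0 marginal_ratio_potential_gt0//.
by rewrite finset.setDE finset.subsetIr.
Qed.

End unique_null_coalition.

End proportional_values_facts.

Theorem proposition1 (R : realType) (disp : measure_display)
    (T : measurableType disp) (P : probability T R) (d : nat)
    (X : {RV P >-> d.-tuple R}) (G : d.-tuple R -> R) (E : {set 'I_d})
    (hX : no_deterministic_input X)
    (hG : G \in Lfun (distribution P X) 2%:E)
    (hV : (0 < 'V_P[G \o X])%E)
    (hE : L2_exogenous G X E)
    (hmax : forall A : {set 'I_d}, A != E -> (#|E| <= #|A|)%N ->
      ~ L2_exogenous G X A) :
  (forall i : 'I_d, i \in E -> PME G X i = 0) /\
  (forall j : 'I_d, j \notin E -> 0 < PME G X j).
Proof.
have S0 := total_sobol_eq0 hG hV.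
have hE0 := (S0 E).2 hE.
have hmax0 (A : {set 'I_d}) : A != E -> (#|E| <= #|A|)%N ->
    total_sobol G X A != 0.
  by move=> AE cA; apply/eqP => /(S0 A).1; exact: hmax.
split=> [i iE|j jE]; first exact: (PV0_null hE0 hmax0).
by apply: (PV0_gt0 (E := E)) => //; exact: total_sobol_ge0.
Qed.
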